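(* Let $X$ be a locally compact, connected Hausdorff space. Suppose $\nu$ and $\mu$ are signed topological measures on $X$, at least one of which has a finite norm. Then $\lambda=\nu-\mu$ is a signed topological measure. If $\mu\le\nu$, then $\lambda=\nu-\mu$ is a topological measure.
   Context: $\mathscr{O}(X)$, $\mathscr{C}(X)$, $\mathscr{K}(X)$ denote the collections of open, closed, compact subsets of $X$; $\sqcup$ denotes a disjoint union. Set functions into the extended reals are assumed not identically $\infty$ or $-\infty$. Relations between set functions are on $\mathscr{O}(X)\cup\mathscr{C}(X)$. A signed topological measure is $\mu:\mathscr{O}(X)\cup\mathscr{C}(X)\to[-\infty,\infty]$ assuming at most one of $\infty,-\infty$ such that: if $A,B,A\sqcup B\in\mathscr{K}(X)\cup\mathscr{O}(X)$ then $\mu(A\sqcup B)=\mu(A)+\mu(B)$; $\mu(U)=\lim\{\mu(K):K\in\mathscr{K}(X), K\subseteq U\}$ for $U$ open (limit of the net indexed by compact subsets of $U$ ordered by inclusion); $\mu(F)=\lim\{\mu(U):U\in\mathscr{O}(X), F\subseteq U\}$ for $F$ closed (limit of the net indexed by open supersets of $F$ ordered by reverse inclusion). Its norm is $\|\mu\|=\sup\{|\mu(K)|:K\in\mathscr{K}(X)\}$. A topological measure is $\mu:\mathscr{C}(X)\cup\mathscr{O}(X)\to[0,\infty]$ such that: if $A,B,A\sqcup B\in\mathscr{K}(X)\cup\mathscr{O}(X)$ then $\mu(A\sqcup B)=\mu(A)+\mu(B)$; $\mu(U)=\sup\{\mu(K):K\in\mathscr{K}(X),K\subseteq U\}$ for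 $U$ open; $\mu(F)=\inf\{\mu(U):U\in\mathscr{O}(X),F\subseteq U\}$ for $F$ closed. *)

(* Defs.v *)
From HB Require Import structures.
From mathcomp Require Import all_boot all_order all_algebra.
From mathcomp Require Import all_classical all_reals all_analysis.

Set Implicit Arguments.
Unset Strict Implicit.
Unset Printing Implicit Defensive.

Import Order.TTheory GRing.Theory Num.Theory.
Import numFieldNormedType.Exports.

Local Open Scope classical_set_scope.
Local Open Scope ring_scope.
Local Open Scope ereal_scope.

(* Set functions on O(X) `|` C(X) are total functions on [set X]; their values
   on sets that are neither open nor closed play no role in any definition. *)
Definition open_or_closed (X : topologicalType) (A : set X) : Prop :=
  open A \/ closed A.

Definition compact_or_open (X : topologicalType) (A : set X) : Prop :=
  compact A \/ open A.

(* The section filters of the two nets: compact subsets of U ordered by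
   inclusion, open supersets of F ordered by reverse inclusion. *)
Definition compact_subsets (X : topologicalType) (U : set X) :
    set_system (set X) :=
  filter_from [set K | compact K /\ K `<=` U]
    (fun K => [set K' | [/\ compact K', K' `<=` U & K `<=` K']]).

Definition open_supersets (X : topologicalType) (F : set X) :
    set_system (set X) :=
  filter_from [set V | open V /\ F `<=` V]
    (fun V => [set V' | [/\ open V', F `<=` V' & V' `<=` V]]).

Instance compact_subsets_proper (X : topologicalType) (U : set X) :
  ProperFilter (compact_subsets U).
Proof.
apply: filter_from_proper.
  apply: filter_from_filter.
    by exists set0; split; [exact: compact0|exact: sub0set].
  move=> K L [cK KU] [cL LU]; exists (K `|` L).
    by split; [exact: compactU|rewrite subUset].
  by move=> M [cM MU]; rewrite subUset => -[KM LM]; split.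
by move=> K [cK KU]; exists K; split.
Qed.

Instance open_supersets_proper (X : topologicalType) (F : set X) :
  ProperFilter (open_supersets F).
Proof.
apply: filter_from_proper.
  apply: filter_from_filter.
    by exists setT; split; [exact: openT|exact: subsetT].
  move=> V W [oV FV] [oW FW]; exists (V `&` W).
    by split; [exact: openI|rewrite subsetI].
  by move=> M [oM FM]; rewrite subsetI => -[MV MW]; split.
by move=> V [oV FV]; exists V; split.
Qed.

Section set_functions.
Context {R : realType} {X : topologicalType}.
Implicit Types mu nu : set X -> \bar R.

Definition not_identically_infinite mu : Prop :=
  ~ (forall A, open_or_closed A -> mu A = +oo) /\
  ~ (forall A, open_or_closed A -> mu A = -oo).

Definition at_most_one_infinity mu : Prop :=
  ~ ((exists2 A, open_or_closed A & mu A = +oo) /\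
     (exists2 B, open_or_closed B & mu B = -oo)).

Definition disjoint_additive mu : Prop :=
  forall A B, compact_or_open A -> compact_or_open B ->
    compact_or_open (A `|` B) -> A `&` B = set0 ->
    mu (A `|` B) = mu A + mu B.

Record signed_topological_measure mu : Prop := {
  stm_not_infinite : not_identically_infinite mu ;
  stm_one_infinity : at_most_one_infinity mu ;
  stm_additive : disjoint_additive mu ;
  stm_inner : forall U, open U -> mu K @[K --> compact_subsets U] --> mu U ;
  stm_outer : forall F, closed F -> mu V @[V --> open_supersets F] --> mu F
}.

Record topological_measure mu : Prop := {
  tm_not_infinite : not_identically_infinite mu ;
  tm_ge0 : forall A, open_or_closed A -> 0 <= mu A ;
  tm_additive : disjoint_additive mu ;
  tm_inner : forall U, open U ->
    mu U = ereal_sup [set mu K | K in [set K | compact K /\ K `<=` U]] ;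
  tm_outer : forall F, closed F ->
    mu F = ereal_inf [set mu V | V in [set V | open V /\ F `<=` V]]
}.

Definition stm_norm mu : \bar R := ereal_sup [set `|mu K| | K in compact].

Definition le_set_function mu nu : Prop :=
  forall A, open_or_closed A -> mu A <= nu A.

End set_functions.

(* Main.v *)
Require Import Defs.
From HB Require Import structures.
From mathcomp Require Import all_boot all_order all_algebra.
From mathcomp Require Import all_classical all_reals all_analysis.

Set Implicit Arguments.
Unset Strict Implicit.
Unset Printing Implicit Defensive.

Import Order.TTheory GRing.Theory Num.Theory.
Import numFieldNormedType.Exports.

Local Open Scope classical_set_scope.
Local Open Scope ring_scope.
Local Open Scope ereal_scope.

(** Since [nu - mu] is [nu + (- mu)], the first claim splits into two closure
    properties of signed topological measures: under negation ([stm_opp]), and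
    under the addition of one that is finite on all open and all closed sets
    ([stm_add_fin]). Finiteness of one summand keeps every sum determinate, so
    that limits may be added, and keeps infinite values of both signs from
    occurring in the sum. It follows from finiteness of the norm: the norm
    bounds [`|mu K|] for compact [K], this bound passes to the limit from the
    compact sets to the open sets, and from these to the closed sets
    ([stm_norm_fin_num]).

    If [mu <= nu], the difference takes values in [[0, +oo]]. A nonnegative
    additive set function is monotone between a compact set and an open set
    around it, as [U = K `|` (U `\` K)], so the limits over the two nets that
    define regularity are a supremum and an infimum ([stm_ge0_tm]).

    The Hausdorff property makes compact sets closed: they are then sets on
    which the set functions are constrained, and [U `\` K] is open. *)

Lemma compact_subsets_near (X : topologicalType) (U : set X)
    (P : set X -> Prop) :
  (forall K, compact K -> K `<=` U -> P K) -> \forall K \near compact_subsets U, P K.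
Proof.
move=> UP; exists set0; first by split; [exact: compact0|exact: sub0set].
by move=> K [cK KU _]; exact: UP.
Qed.

Lemma open_supersets_near (X : topologicalType) (F V : set X)
    (P : set X -> Prop) :
  open V -> F `<=` V ->
  (forall W, open W -> F `<=` W -> W `<=` V -> P W) ->
  \forall W \near open_supersets F, P W.
Proof.
move=> oV FV VP; exists V; first by split.
by move=> W [oW FW WV]; exact: VP.
Qed.

Lemma hausdorff_compact_or_open (X : topologicalType) (A : set X) :
  hausdorff_space X -> compact_or_open A -> open_or_closed A.
Proof.
by move=> hX [cA|oA]; [right; exact: compact_closed|left].
Qed.

Section signed_topological_measures.
Context {R : realType} {X : topologicalType}.
Implicit Types mu nu : set X -> \bar R.

(** Both nets transport an upper bound on [`|mu K|], [K] compact, to their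
    limits, because [`|x| <= stm_norm mu] is a closed condition on [x]. *)
Lemma stm_le_norm mu A :
  signed_topological_measure mu -> open_or_closed A -> `|mu A| <= stm_norm mu.
Proof.
move=> muS; have compact_le K : compact K -> `|mu K| <= stm_norm mu.
  by move=> cK; apply: ereal_sup_ubound; exists K.
have open_le U : open U -> `|mu U| <= stm_norm mu.
  move=> oU; apply: cvge_le (cvg_abse (stm_inner muS oU)).
  by apply: compact_subsets_near => K cK _; exact: compact_le.
case=> [|cA]; first exact: open_le.
apply: cvge_le (cvg_abse (stm_outer muS cA)).
by apply: open_supersets_near openT (@subsetT _ _) _ => V oV _ _; exact: open_le.
Qed.

Lemma stm_norm_fin_num mu A :
  signed_topological_measure mu -> stm_norm mu < +oo -> open_or_closed A ->
  mu A \is a fin_num.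
Proof.
move=> muS norm_fin ocA; rewrite -abse_fin_num ge0_fin_numE//.
by apply: le_lt_trans norm_fin; exact: stm_le_norm.
Qed.

(** Negation commutes with the sum [mu A + mu B] since [mu] omits one of the
    two infinities, so the sum is never [+oo - oo]. *)
Lemma stm_opp mu :
  hausdorff_space X ->
  signed_topological_measure mu -> signed_topological_measure (\- mu).
Proof.
move=> hX [[npinfty nninfty] one_infty add inner outer]; split.
- split=> all_infty; [apply: nninfty|apply: npinfty] => A ocA;
    by rewrite -[mu A]oppeK (all_infty _ ocA).
- move=> [[A ocA muA] [B ocB muB]]; apply: one_infty; split.
    by exists B => //; rewrite -[mu B]oppeK muB.
  by exists A => //; rewrite -[mu A]oppeK muA.
- move=> A B cA cB cAB AB0; rewrite add// oppeD//.
  have ocA := hausdorff_compact_or_open hX cA.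
  have ocB := hausdorff_compact_or_open hX cB.
  rewrite /adde_def; apply/andP; split; apply/negP => /andP[/eqP muA /eqP muB];
    apply: one_infty; split.
  + by exists A.
  + by exists B.
  + by exists B.
  + by exists A.
- by move=> U oU; apply: cvgeN; exact: inner.
- by move=> F cF; apply: cvgeN; exact: outer.
Qed.

Lemma stm_add_fin nu mu :
  signed_topological_measure nu -> signed_topological_measure mu ->
  (forall A, open_or_closed A -> mu A \is a fin_num) ->
  signed_topological_measure (nu \+ mu).
Proof.
move=> nuS muS mu_fin.
have nu_eq A : open_or_closed A -> nu A = nu A + mu A - mu A.
  by move=> ocA; rewrite addeK// mu_fin.
case: nuS => -[npinfty nninfty] one_infty add inner outer; split.
- split=> all_infty; [apply: npinfty|apply: nninfty] => A ocA;
    by rewrite nu_eq// all_infty// -(fineK (mu_fin _ ocA)).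
- move=> [[A ocA nuA] [B ocB nuB]]; apply: one_infty; split.
    by exists A => //; rewrite nu_eq// nuA -(fineK (mu_fin _ ocA)).
  by exists B => //; rewrite nu_eq// nuB -(fineK (mu_fin _ ocB)).
- by move=> A B cA cB cAB AB0; rewrite add// (stm_additive muS)// addeACA.
- move=> U oU; apply: cvgeD; [|exact: inner|exact: stm_inner].
  by rewrite fin_num_adde_defl// mu_fin//; left.
- move=> F cF; apply: cvgeD; [|exact: outer|exact: stm_outer].
  by rewrite fin_num_adde_defl// mu_fin//; right.
Qed.

(** Monotonicity between compact and open sets turns the inner limit into a
    supremum, which makes the measure monotone on open sets. The outer limit at
    a closed [F] is then at most [mu V] for each open [V] around [F]: the net
    is eventually made of open subsets of [V]. Additivity does not give that
    bound directly, as it says nothing about the pair [F], [V `\` F] unless [F]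
    is compact. *)
Lemma stm_ge0_tm mu :
  hausdorff_space X -> signed_topological_measure mu ->
  (forall A, open_or_closed A -> 0 <= mu A) -> topological_measure mu.
Proof.
move=> hX [ninfty one_infty add inner outer] mu_ge0.
have le_compact_open K U : compact K -> open U -> K `<=` U -> mu K <= mu U.
  move=> cK oU KU; have oUK : open (U `\` K).
    by rewrite setDE; apply: openI => //; apply: closed_openC; exact: compact_closed.
  have KUE : K `|` (U `\` K) = U by exact: setDUK.
  rewrite -KUE add ?KUE; [|by left|by right|by right|exact: setDIK].
  by rewrite leeDl// mu_ge0//; left.
have inner_sup U : open U ->
    mu U = ereal_sup [set mu K | K in [set K | compact K /\ K `<=` U]].
  move=> oU; apply/eqP; rewrite eq_le; apply/andP; split.
    apply: cvge_le (inner U oU); apply: compact_subsets_near => K cK KU.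
    by apply: ereal_sup_ubound; exists K.
  by apply: ge_ereal_sup => _ [K [cK KU] <-]; exact: le_compact_open.
split=> // F cF; apply/eqP; rewrite eq_le; apply/andP; split.
  apply: le_ereal_inf_tmp => _ [V [oV FV] <-].
  apply: cvge_le (outer F cF); apply: (open_supersets_near oV FV) => W oW _ WV.
  rewrite inner_sup//; apply: ge_ereal_sup => _ [K [cK KW] <-].
  by apply: le_compact_open => //; exact: subset_trans WV.
apply: cvge_ge (outer F cF).
apply: (open_supersets_near openT (@subsetT _ _)) => V oV FV _.
by apply: ereal_inf_lbound; exists V.
Qed.

End signed_topological_measures.

Theorem theorem5p1 (R : realType) (X : topologicalType)
    (X_lc : locally_compact [set: X])
    (X_conn : connected [set: X])
    (X_haus : hausdorff_space X)
    (nu mu : set X -> \bar R)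
    (nu_stm : signed_topological_measure nu)
    (mu_stm : signed_topological_measure mu)
    (fin_norm : stm_norm nu < +oo \/ stm_norm mu < +oo) :
  signed_topological_measure (nu \- mu) /\
  (le_set_function mu nu -> topological_measure (nu \- mu)).
Proof.
have diff_stm : signed_topological_measure (nu \- mu).
  have oppmu_stm := stm_opp X_haus mu_stm.
  case: fin_norm => [nu_fin|mu_fin].
    have -> : nu \- mu = (\- mu) \+ nu by apply/funext => A; exact: addeC.
    by apply: stm_add_fin => // A; exact: stm_norm_fin_num.
  apply: (stm_add_fin nu_stm oppmu_stm) => A ocA.
  by rewrite fin_numN; exact: stm_norm_fin_num.
split=> // le_mu_nu; apply: stm_ge0_tm => // A ocA.
rewrite sube_ge0; first exact: le_mu_nu.
by case: fin_norm => norm_fin; apply/orP; [right|left]; exact: stm_norm_fin_num.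
Qed.
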